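(* Let $q$ be a prime power, let $2\le m < k$ be integers, and let $L$ be an $(m \times k)$-system over $\mathbb{F}_q$. If there exist $n \ge 1$ and a balanced function $f: \mathbb{F}_q^n \rightarrow [-\frac 12, \frac 12]$ such that $\sum_{B \in \mathcal{C}(L)} \Lambda_{L_B} (f) <0$, then $L$ is uncommon.
   Context: A system of $m$ linear forms in $k$ variables over $\mathbb{F}_q$ is identified with its $m\times k$ coefficient matrix; it is an $(m\times k)$-system if the rows are linearly independent over $\mathbb{F}_q$. For $A\subseteq\mathbb{F}_q^n$, $\mathrm{sol}(L;A)=\{\mathbf{x}\in A^k: L\mathbf{x}^T=0\}$. For $B=\{i_1<\dots<i_\ell\}\subseteq[k]$ and an $\ell$-variable system $L'$, $L$ induces $L'$ on $B$ if for every $\mathbf{x}\in\mathbb{F}_q^k$, $L(\mathbf{x})=0$ implies $L'(x_{i_1},\dots,x_{i_\ell})=0$. The length of an equation is its number of nonzero coefficients; $s(L)$ is the minimal length of a (nontrivial) equation induced by $L$; $c(L)=s(L)$ if $s(L)$ is even and $c(L)=s(L)+1$ otherwise. $B\subseteq[k]$ is critical if $|B|=c(L)$ and some (nontrivial) system is induced by $L$ on $B$; $\mathcal{C}(L)$ is the family of critical sets. For $B\in\mathcal{C}(L)$, $m_B$ is the maximal $m'$ such that an $(m'\times|B|)$-system is induced by $L$ on $B$, and $L_B$ is the $(m_B\times|B|)$-system induced by $L$ on $B$ (unique up to row operations). For a $k'$-variable system $L'$ and $f:\mathbb{F}_q^n\to\mathbb{R}$, $\Lambda_{L'}(f)=\frac{1}{|\mathrm{sol}(L';\mathbb{F}_q^n)|}\sum_{\mathbf{x}\in\mathrm{sol}(L';\mathbb{F}_q^n)}\prod_{i=1}^{k'}f(x_i)$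 and $\Delta_{L'}(f)=\Lambda_{L'}(1/2+f)+\Lambda_{L'}(1/2-f)$. $f$ is balanced if $\sum_{x\in\mathbb{F}_q^n}f(x)=0$. A $k$-variable system $L$ is common if for every $n\ge1$ and every $f:\mathbb{F}_q^n\to[-1/2,1/2]$, $\Delta_L(f)\ge 2^{1-k}$; otherwise uncommon. *)

(* Defs.v *)
From HB Require Import structures.
From mathcomp Require Import all_boot all_order all_algebra.
From mathcomp Require Import reals.

Set Implicit Arguments.
Unset Strict Implicit.
Unset Printing Implicit Defensive.

Import Order.TTheory GRing.Theory Num.Theory.

Local Open Scope ring_scope.

(* F is the field with q elements.  A tuple (x_1, ..., x_k) of points of F^n is
   encoded as the k x n matrix X whose i-th row is x_i, so that the equation
   L x^T = 0 reads L *m X = 0. *)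
Definition sol (F : finFieldType) (m k n : nat) (L : 'M[F]_(m, k))
    (A : {set 'rV[F]_n}) : {set 'M[F]_(k, n)} :=
  [set X : 'M[F]_(k, n) | (L *m X == 0) && [forall i, row i X \in A]].

(* enum_val lists B in increasing order. *)
Definition restrict (F : finFieldType) (k : nat) (B : {set 'I_k})
    (x : 'cV[F]_k) : 'cV[F]_#|B| :=
  rowsub (fun j : 'I_#|B| => enum_val j) x.

Definition induces (F : finFieldType) (m k m' : nat) (L : 'M[F]_(m, k))
    (B : {set 'I_k}) (L' : 'M[F]_(m', #|B|)) : bool :=
  [forall x : 'cV[F]_k, (L *m x == 0) ==> (L' *m restrict B x == 0)].

Definition eq_length (F : finFieldType) (l : nat) (e : 'rV[F]_l) : nat :=
  #|[set j : 'I_l | e 0 j != 0]|.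

(* The default value k is an upper bound for all lengths, so this is the
   minimum as soon as L != 0. *)
Definition min_length (F : finFieldType) (m k : nat) (L : 'M[F]_(m, k)) : nat :=
  \big[minn/k]_(B : {set 'I_k})
    \big[minn/k]_(e : 'rV[F]_#|B| | (e != 0) && induces L e) eq_length e.

Definition crit_size (F : finFieldType) (m k : nat) (L : 'M[F]_(m, k)) : nat :=
  if odd (min_length L) then (min_length L).+1 else min_length L.

Definition induces_system (F : finFieldType) (m k : nat) (L : 'M[F]_(m, k))
    (B : {set 'I_k}) (m' : nat) : bool :=
  [exists L' : 'M[F]_(m', #|B|), row_free L' && induces L L'].

(* Linear independence of the rows forces m' <= #|B|, whence the bound on m'
   here and in max_induced; the trivial system is the one with m' = 0. *)
Definition critical (F : finFieldType) (m k : nat) (L : 'M[F]_(m, k))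
    (B : {set 'I_k}) : bool :=
  (#|B| == crit_size L) &&
  [exists m' : 'I_#|B|.+1, (0 < m')%N && induces_system L B m'].

Definition critical_sets (F : finFieldType) (m k : nat) (L : 'M[F]_(m, k)) :
    {set {set 'I_k}} :=
  [set B | critical L B].

Definition max_induced (F : finFieldType) (m k : nat) (L : 'M[F]_(m, k))
    (B : {set 'I_k}) : nat :=
  \max_(m' < #|B|.+1 | induces_system L B m') m'.

(* A choice of L_B, which is unique up to row operations; the default 0 is
   never used (induced_mxP). *)
Definition induced_mx (F : finFieldType) (m k : nat) (L : 'M[F]_(m, k))
    (B : {set 'I_k}) : 'M[F]_(max_induced L B, #|B|) :=
  odflt 0 [pick L' : 'M[F]_(max_induced L B, #|B|)
             | row_free L' && induces L L'].

Lemma induced_mxP (F : finFieldType) (m k : nat) (L : 'M[F]_(m, k))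
    (B : {set 'I_k}) :
  row_free (induced_mx L B) /\ induces L (induced_mx L B).
Proof.
rewrite /induced_mx; case: pickP => [L' /andP[] // | noL'].
suff: induces_system L B (max_induced L B).
  by case/existsP => L'; rewrite noL'.
pose P : pred 'I_#|B|.+1 := fun m' => induces_system L B m'.
have h0 : P ord0.
  apply/existsP; exists 0; rewrite /row_free mxrank0 eqxx /=.
  by apply/forallP => x; rewrite mul0mx eqxx implybT.
by rewrite /max_induced (@bigop.bigmax_eq_arg _ ord0 P _ h0); case: fintype.arg_maxnP.
Qed.

Definition Lambda (F : finFieldType) (R : realType) (m k n : nat)
    (L : 'M[F]_(m, k)) (f : 'rV[F]_n -> R) : R :=
  (#|sol L [set: 'rV[F]_n]|%:R)^-1 *
  \sum_(X in sol L [set: 'rV[F]_n]) \prod_(i < k) f (row i X).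

Definition Delta (F : finFieldType) (R : realType) (m k n : nat)
    (L : 'M[F]_(m, k)) (f : 'rV[F]_n -> R) : R :=
  Lambda L (fun x => 1 / 2 + f x) + Lambda L (fun x => 1 / 2 - f x).

Definition balanced (F : finFieldType) (R : realType) (n : nat)
    (f : 'rV[F]_n -> R) : Prop :=
  \sum_(x : 'rV[F]_n) f x = 0.

Definition common (F : finFieldType) (R : realType) (m k : nat)
    (L : 'M[F]_(m, k)) : Prop :=
  forall (n : nat) (f : 'rV[F]_n -> R),
    (1 <= n)%N -> (forall x, - (1 / 2) <= f x <= 1 / 2) ->
    (2 : R) ^ (1 - k%:Z) <= Delta L f.

Definition uncommon (F : finFieldType) (R : realType) (m k : nat)
    (L : 'M[F]_(m, k)) : Prop :=
  ~ common R L.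

(* Main.v *)
(** Write [S] for a set of coordinates and [T_S] for the average of
    [\prod_(i in S) f x_i] over the solutions [x] of [L].  Expanding products,
    [Delta L (e f) = \sum_S 2^(|S|-k) (1 + (-1)^|S|) e^|S| T_S].
    Restricting solutions of [L] to [S] is a linear surjection onto the
    solutions of [L_S], with fibres of constant size, so [T_S = Lambda L_S f].
    If [L] induces no equation on a nonempty [S], then [T_S] is a power of the
    mean of [f], hence 0.  So beyond [S = set0], which contributes [2^(1-k)],
    the leading term is of order [e^c(L)], with coefficient a positive multiple
    of the sum over the critical sets; it is negative, and dominates the other
    terms for small [e > 0]. *)
Require Import Defs.
From HB Require Import structures.
From mathcomp Require Import all_boot all_order all_algebra.
From mathcomp Require Import reals.
From mathcomp Require Import ring lra.

Set Implicit Arguments.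
Unset Strict Implicit.
Unset Printing Implicit Defensive.

Import Order.TTheory GRing.Theory Num.Theory.

Local Open Scope ring_scope.

(** * Averages over solution spaces and their images under linear maps *)

Lemma mem_solT (F : finFieldType) (m k n : nat) (L : 'M[F]_(m, k))
    (X : 'M[F]_(k, n)) : (X \in sol L [set: 'rV[F]_n]) = (L *m X == 0).
Proof.
by rewrite inE; case: eqP => //= _; apply/forallP => i; rewrite inE.
Qed.

(** Allows arbitrary functions of a solution, since a product over only some of the coordinates is
    not of the form required by [Lambda]. *)
Definition sol_avg (F : finFieldType) (R : realType) (m k n : nat)
    (L : 'M[F]_(m, k)) (g : 'M[F]_(k, n) -> R) : R :=
  (#|sol L [set: 'rV[F]_n]|%:R)^-1 *
  \sum_(X in sol L [set: 'rV[F]_n]) g X.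

Lemma sol_card_neq0 (F : finFieldType) (R : realType) (m k n : nat)
    (L : 'M[F]_(m, k)) : #|sol L [set: 'rV[F]_n]|%:R != 0 :> R.
Proof.
rewrite pnatr_eq0 -lt0n; apply/card_gt0P; exists 0.
by rewrite mem_solT mulmx0.
Qed.

(** Each fibre of [X |-> P *m X] over a solution of [L'] is a translate of the solutions of [L]
    killed by [P], so all fibres have the same size. *)
Lemma sum_sol_pushforward (F : finFieldType) (R : realType) (m k m' l n : nat)
    (L : 'M[F]_(m, k)) (L' : 'M[F]_(m', l)) (P : 'M[F]_(l, k))
    (PL : forall X : 'M[F]_(k, n), L *m X = 0 -> L' *m (P *m X) = 0)
    (LP : forall Y : 'M[F]_(l, n), L' *m Y = 0 ->
       exists2 X, L *m X = 0 & P *m X = Y)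
    (g : 'M[F]_(l, n) -> R) :
  \sum_(X in sol L [set: 'rV[F]_n]) g (P *m X) =
  #|[set X : 'M[F]_(k, n) | (L *m X == 0) && (P *m X == 0)]|%:R *
  \sum_(Y in sol L' [set: 'rV[F]_n]) g Y.
Proof.
rewrite (partition_big (fun X => P *m X)
  (fun Y => Y \in sol L' [set: 'rV[F]_n])) /=; last first.
  by move=> X; rewrite !mem_solT => /eqP /PL ->.
rewrite mulr_sumr; apply: eq_bigr => Y; rewrite mem_solT => /eqP /LP[X0 LX0 PX0].
rewrite (eq_bigr (fun=> g Y)); last by move=> X /andP[_ /eqP ->].
rewrite sumr_const mulr_natl; congr (_ *+ _).
rewrite -[RHS](card_imset _ (addrI X0)).
apply: eq_card => X; rewrite unfold_in mem_solT; apply/andP/imsetP.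
- move=> [/eqP LX /eqP PX]; exists (X - X0).
    by rewrite inE !mulmxBr LX LX0 PX PX0 !subrr !eqxx.
  by rewrite [RHS]addrC subrK.
- move=> [Z]; rewrite inE => /andP[/eqP LZ /eqP PZ] ->.
  by rewrite !mulmxDr LX0 LZ PX0 PZ !addr0 !eqxx.
Qed.

Lemma sol_avg_pushforward (F : finFieldType) (R : realType) (m k m' l n : nat)
    (L : 'M[F]_(m, k)) (L' : 'M[F]_(m', l)) (P : 'M[F]_(l, k))
    (PL : forall X : 'M[F]_(k, n), L *m X = 0 -> L' *m (P *m X) = 0)
    (LP : forall Y : 'M[F]_(l, n), L' *m Y = 0 ->
       exists2 X, L *m X = 0 & P *m X = Y)
    (g : 'M[F]_(l, n) -> R) :
  sol_avg L (fun X => g (P *m X)) = sol_avg L' g.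
Proof.
rewrite /sol_avg (sum_sol_pushforward PL LP).
(* The constant function 1 turns the identity into a count of solutions, so the fibre size
   cancels. *)
have := sum_sol_pushforward PL LP (fun=> 1 : R).
rewrite !sumr_const => cardE.
have N0 := sol_card_neq0 R n L; have N'0 := sol_card_neq0 R n L'.
rewrite cardE in N0 *.
set c := #|_|%:R in N0 *.
have c0 : c != 0 by apply: contraNneq N0 => ->; rewrite mul0r.
by field; rewrite c0 N'0.
Qed.

(** Double annihilator: the row space of [A^T] lies in that of [kermx (kermx A)^T], and rank-nullity
    applied twice gives both the same dimension. *)
Lemma kermx_mul_eq0 (F : fieldType) (l p n : nat) (A : 'M[F]_(l, p))
    (Y : 'M[F]_(l, n)) :
  kermx A *m Y = 0 -> exists Z, Y = A *m Z.
Proof.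
move=> kY.
have AK : (A^T <= kermx (kermx A)^T)%MS.
  by apply/sub_kermxP; rewrite -trmx_mul mulmx_ker trmx0.
have KA : (kermx (kermx A)^T <= A^T)%MS.
  rewrite -(mxrank_leqif_sup AK) mxrank_ker !mxrank_tr mxrank_ker.
  by rewrite subKn // rank_leq_row.
have /submxP[Z YZ] : (Y^T <= A^T)%MS.
  by apply: submx_trans KA; apply/sub_kermxP; rewrite -trmx_mul kY trmx0.
by exists Z^T; rewrite -[Y]trmxK YZ trmx_mul trmxK.
Qed.

(** * Induced systems described by a kernel *)

Definition restr_mx (F : finFieldType) (k : nat) (B : {set 'I_k}) :
    'M[F]_(#|B|, k) :=
  rowsub (fun j : 'I_#|B| => enum_val j) 1%:M.

Lemma restr_mxE (F : finFieldType) (k n : nat) (B : {set 'I_k})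
    (X : 'M[F]_(k, n)) :
  restr_mx F B *m X = rowsub (fun j : 'I_#|B| => enum_val j) X.
Proof. by rewrite /restr_mx mul_rowsub_mx mul1mx. Qed.

(* The columns of [sol_basis L] span the solutions of [L]. *)
Definition sol_basis (F : finFieldType) (m k : nat) (L : 'M[F]_(m, k)) :
    'M[F]_k := (kermx L^T)^T.

Lemma mul_sol_basis (F : finFieldType) (m k : nat) (L : 'M[F]_(m, k)) :
  L *m sol_basis L = 0.
Proof. by apply: trmx_inj; rewrite trmx_mul trmxK mulmx_ker trmx0. Qed.

Lemma sol_basisP (F : finFieldType) (m k n : nat) (L : 'M[F]_(m, k))
    (X : 'M[F]_(k, n)) :
  L *m X = 0 -> exists Z, X = sol_basis L *m Z.
Proof.
move=> LX; have /submxP[Z XZ] : (X^T <= kermx L^T)%MS.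
  by apply/sub_kermxP; rewrite -trmx_mul LX trmx0.
by exists Z^T; rewrite -[X]trmxK XZ trmx_mul.
Qed.

(** It suffices to test [L'] on the columns of [sol_basis L]. Everything induced on [B] is thus
    contained in a single row space. *)
Lemma inducesE (F : finFieldType) (m k m' : nat) (L : 'M[F]_(m, k))
    (B : {set 'I_k}) (L' : 'M[F]_(m', #|B|)) :
  induces L L' = (L' <= kermx (restr_mx F B *m sol_basis L))%MS.
Proof.
apply/forallP/sub_kermxP => [ind | ker x].
- apply/matrixP => i j; have := ind (col j (sol_basis L)).
  rewrite /restrict -restr_mxE colE !mulmxA mul_sol_basis mul0mx eqxx /=.
  by move=> /eqP/colP/(_ i); rewrite -colE mxE [RHS]mxE => ->; rewrite mxE.
- apply/implyP => /eqP /sol_basisP[Z ->].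
  by rewrite /restrict -restr_mxE !mulmxA -(mulmxA L') ker mul0mx.
Qed.

Lemma max_inducedE (F : finFieldType) (m k : nat) (L : 'M[F]_(m, k))
    (B : {set 'I_k}) :
  max_induced L B = \rank (kermx (restr_mx F B *m sol_basis L)).
Proof.
apply/eqP; rewrite eqn_leq; apply/andP; split.
- apply/bigmax_leqP => m' /existsP[L' /andP[/eqP freeL']].
  by rewrite inducesE => /mxrankS; rewrite freeL'.
- set K := kermx _.
  have rK : (\rank K < #|B|.+1)%N by rewrite ltnS rank_leq_row.
  apply: (bigop.leq_bigmax_cond (Ordinal rK)) => /=.
  by apply/existsP; exists (row_base K); rewrite row_base_free inducesE -/K eq_row_base submx_refl.
Qed.

Lemma induced_mx_eqmx (F : finFieldType) (m k : nat) (L : 'M[F]_(m, k))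
    (B : {set 'I_k}) :
  (induced_mx L B == kermx (restr_mx F B *m sol_basis L))%MS.
Proof.
have [/eqP rL indL] := induced_mxP L B; rewrite inducesE in indL.
apply/andP; split=> //.
by rewrite -(mxrank_leqif_sup indL) rL max_inducedE.
Qed.

(** Restriction to [B] maps solutions of [L] onto those of [induced_mx L B]: a [Y] killed by the
    whole kernel of [restr_mx F B *m sol_basis L] is in its image by [kermx_mul_eq0]. This covers
    every [B], critical or not. *)
Lemma Lambda_induced (F : finFieldType) (R : realType) (m k n : nat)
    (L : 'M[F]_(m, k)) (B : {set 'I_k}) (f : 'rV[F]_n -> R) :
  Lambda (induced_mx L B) f = sol_avg L (fun X => \prod_(i in B) f (row i X)).
Proof.
have /andP[indK Kind] := induced_mx_eqmx L B.
rewrite -[LHS]/(sol_avg _ (fun X => \prod_(j < #|B|) f (row j X))).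
rewrite -(@sol_avg_pushforward F R m k _ _ n L _ (restr_mx F B)).
- rewrite /sol_avg; congr (_ * _); apply: eq_bigr => X _.
  rewrite [RHS]big_enum_val; apply: eq_bigr => j _; congr f.
  by rewrite restr_mxE; apply/rowP => c; rewrite !mxE.
- move=> X /sol_basisP[Z ->]; rewrite !mulmxA -(mulmxA (induced_mx L B)).
  by move/sub_kermxP: indK => ->; rewrite mul0mx.
- move=> Y IY; have [|Z ->] := @kermx_mul_eq0 _ _ _ _ (restr_mx F B *m sol_basis L) Y.
    by case/submxP: Kind => D ->; rewrite -mulmxA IY mulmx0.
  exists (sol_basis L *m Z); last by rewrite mulmxA.
  by rewrite mulmxA mul_sol_basis mul0mx.
Qed.

(** * Sets of coordinates whose contribution vanishes *)

Lemma sum_prod_rows (F : finFieldType) (R : realType) (l n : nat)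
    (f : 'rV[F]_n -> R) :
  \sum_(X : 'M[F]_(l, n)) \prod_(i < l) f (row i X) =
  \prod_(i < l) \sum_x f x.
Proof.
rewrite bigA_distr_bigA /=.
rewrite (reindex (fun g : {ffun 'I_l -> 'rV[F]_n} => \matrix_i g i)) /=.
  by apply: eq_bigr => g _; apply: eq_bigr => i _; rewrite rowK.
exists (fun X : 'M[F]_(l, n) => [ffun i => row i X]) => [g _|X _].
  by apply/ffunP => i; rewrite ffunE rowK.
by apply/row_matrixP => i; rewrite rowK ffunE.
Qed.

(** A system of rank 0 is solved by every matrix, so the sum factors into a positive power of
    [\sum_x f x = 0]. *)
Lemma Lambda_induced_trivial (F : finFieldType) (R : realType) (m k n : nat)
    (L : 'M[F]_(m, k)) (B : {set 'I_k}) (f : 'rV[F]_n -> R) :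
  balanced f -> (0 < #|B|)%N -> max_induced L B = 0%N ->
  Lambda (induced_mx L B) f = 0.
Proof.
move=> f0 B0 ind0; rewrite /Lambda.
rewrite (eq_bigl predT) => [|X]; last first.
  rewrite mem_solT; apply/eqP; have [/eqP rL _] := induced_mxP L B.
  have /eqP -> : induced_mx L B == 0 by rewrite -mxrank_eq0 rL ind0.
  by rewrite mul0mx.
by rewrite sum_prod_rows f0 prodr_const card_ord expr0n gtn_eqF // mulr0.
Qed.

(** Any nonzero row of [induced_mx L B] is an induced equation, of length at most [#|B|]. *)
Lemma induces_min_length (F : finFieldType) (m k : nat) (L : 'M[F]_(m, k))
    (B : {set 'I_k}) :
  (0 < max_induced L B)%N -> (min_length L <= #|B|)%N.
Proof.
move=> ind; have [/eqP rL indL] := induced_mxP L B.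
have /rowV0Pn[e eL e0] : induced_mx L B != 0 by rewrite -mxrank_eq0 rL -lt0n.
have inde : induces L e by rewrite inducesE (submx_trans eL) // -inducesE.
have eB : (eq_length e <= #|B|)%N.
  by rewrite /eq_length -[leqRHS]card_ord max_card.
rewrite /min_length -minEnat -leEnat.
apply: (@bigmin_inf _ _ _ _ B) => //.
by apply: (@bigmin_inf _ _ _ _ e); rewrite ?e0 // leEnat.
Qed.

Lemma not_critical_trivial (F : finFieldType) (m k : nat) (L : 'M[F]_(m, k))
    (B : {set 'I_k}) :
  #|B| = crit_size L -> B \notin critical_sets L -> max_induced L B = 0%N.
Proof.
move=> cB; rewrite inE => /nandP[/eqP //|nB].
apply/eqP; rewrite -leqn0 leqNgt; apply: contra nB => ind.
have mB : (max_induced L B < #|B|.+1)%N.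
  by rewrite max_inducedE ltnS rank_leq_row.
have [fL iL] := induced_mxP L B.
apply/existsP; exists (Ordinal mB); rewrite ind /=.
by apply/existsP; exists (induced_mx L B); rewrite fL.
Qed.

(** As [crit_size L] rounds [min_length L] up to an even number, an even size below the former is
    also below the latter. *)
Lemma small_even_trivial (F : finFieldType) (m k : nat) (L : 'M[F]_(m, k))
    (B : {set 'I_k}) :
  ~~ odd #|B| -> (#|B| < crit_size L)%N -> max_induced L B = 0%N.
Proof.
move=> eB cB; apply/eqP; rewrite -leqn0 leqNgt; apply/negP => /induces_min_length.
rewrite leq_eqVlt => /orP[/eqP eq|lt]; move: cB; rewrite /crit_size.
  by rewrite eq (negPf eB) ltnn.
by case: ifP => _; rewrite ?ltnS leqNgt ?lt // ltnW.
Qed.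

Lemma crit_size_even (F : finFieldType) (m k : nat) (L : 'M[F]_(m, k)) :
  ~~ odd (crit_size L).
Proof. by rewrite /crit_size; case: ifP => //= ->. Qed.

Lemma critical_card_gt0 (F : finFieldType) (m k : nat) (L : 'M[F]_(m, k))
    (B : {set 'I_k}) :
  B \in critical_sets L -> (0 < crit_size L)%N.
Proof.
rewrite inE => /andP[/eqP <- /existsP[[m' /= m'B] /andP[m0 _]]].
exact: leq_trans m0 m'B.
Qed.

(** * Expansion of [Delta] in powers of [t] *)

Lemma Lambda_expand (F : finFieldType) (R : realType) (m k n : nat)
    (L : 'M[F]_(m, k)) (f : 'rV[F]_n -> R) (a t : R) :
  Lambda L (fun x => a + t * f x) =
  \sum_(B : {set 'I_k})
    t ^+ #|B| * a ^+ (k - #|B|) * Lambda (induced_mx L B) f.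
Proof.
under [RHS]eq_bigr => B _ do rewrite Lambda_induced /sol_avg mulrCA mulr_sumr.
rewrite -mulr_sumr exchange_big /=; congr (_ * _); apply: eq_bigr => X _ /=.
(* With [t * f] as first summand, [bigA_distr] indexes the terms by the set [B] of factors where it
   is chosen. *)
under eq_bigr => i _ do rewrite addrC.
rewrite bigA_distr; apply: eq_bigr => B _.
rewrite (bigID (mem B)) /=.
rewrite (eq_bigr (fun i => t * f (row i X))); last by move=> i ->.
rewrite [X in _ * X](eq_bigr (fun=> a)); last by move=> i /negPf ->.
rewrite big_split /= !prodr_const mulrAC; congr (_ * _ ^+ _ * _).
transitivity (#|'I_k| - #|B|)%N; last by rewrite card_ord.
by rewrite -(cardC (mem B)) addKn; apply: eq_card.
Qed.

Lemma Delta_expand (F : finFieldType) (R : realType) (m k n : nat)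
    (L : 'M[F]_(m, k)) (f : 'rV[F]_n -> R) (t : R) :
  Delta L (fun x => t * f x) =
  \sum_(B : {set 'I_k} | ~~ odd #|B|)
    2 * t ^+ #|B| * (1 / 2) ^+ (k - #|B|) * Lambda (induced_mx L B) f.
Proof.
rewrite /Delta Lambda_expand.
have -> : Lambda L (fun x => 1 / 2 - t * f x) =
          Lambda L (fun x => 1 / 2 + (- t) * f x).
  rewrite /Lambda; congr (_ * _); apply: eq_bigr => X _.
  by apply: eq_bigr => i _; rewrite mulNr.
rewrite Lambda_expand -big_split /= [RHS]big_mkcond; apply: eq_bigr => B _.
by rewrite exprNn -signr_odd; case: odd => /=; ring.
Qed.

Lemma Lambda_induced0 (F : finFieldType) (R : realType) (m k n : nat)
    (L : 'M[F]_(m, k)) (f : 'rV[F]_n -> R) :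
  Lambda (induced_mx L set0) f = 1.
Proof.
rewrite Lambda_induced /sol_avg (eq_bigr (fun=> 1)) => [|X _].
  by rewrite sumr_const mulVf // sol_card_neq0.
by rewrite big_set0.
Qed.

Lemma Delta_le (F : finFieldType) (R : realType) (m k n : nat)
    (L : 'M[F]_(m, k)) (f : 'rV[F]_n -> R) (t : R) :
  balanced f -> (0 < crit_size L)%N -> 0 <= t <= 1 ->
  Delta L (fun x => t * f x) <=
  2 * (1 / 2) ^+ k +
  2 * t ^+ crit_size L * (1 / 2) ^+ (k - crit_size L) *
    \sum_(B in critical_sets L) Lambda (induced_mx L B) f +
  t ^+ (crit_size L).+1 *
    \sum_(B : {set 'I_k}) 2 * `|Lambda (induced_mx L B) f|.
Proof.
move=> f0 c0 /andP[t0 t1]; rewrite Delta_expand.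
have half_ge0 : 0 <= 1 / 2 :> R by lra.
have half_le1 : 1 / 2 <= 1 :> R by lra.
rewrite (bigD1 set0) /=; last by rewrite cards0.
rewrite Lambda_induced0 cards0 subn0 expr0 !mulr1.
rewrite -addrA lerD2l.
set c := crit_size L.
(* All sums now run over every [B], with 0 where a condition fails, so the comparison is
   termwise. *)
rewrite [X in _ <= X + _]mulr_sumr [X in _ <= X + _]big_mkcond mulr_sumr.
rewrite -big_split /= [X in X <= _]big_mkcond /=; apply: ler_sum => B _.
set T := Lambda _ f.
have T2 : 0 <= t ^+ c.+1 * (2 * `|T|) by rewrite !mulr_ge0 ?exprn_ge0.
have critc : B \in critical_sets L -> #|B| = c by rewrite inE => /andP[/eqP].
have [ev|od] /= := boolP (~~ odd #|B|); last first.
  case: ifP => [/critc Bc|_]; last by rewrite add0r.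
  by move: od; rewrite Bc crit_size_even.
have [B0|Bn0] := eqVneq B set0.
  case: ifP => [/critc|_]; last by rewrite add0r.
  by rewrite B0 cards0 => c0'; move: c0; rewrite -/c -c0'.
have cardB : (0 < #|B|)%N by rewrite card_gt0.
have [lt|gt|eq] := ltngtP #|B| c.
- have -> : T = 0 by apply: Lambda_induced_trivial => //; apply: small_even_trivial.
  rewrite normr0 !mulr0 addr0.
  by case: ifP.
(* Above the critical size, [t <= 1] lets [t ^+ c.+1] absorb the power of [t], and the powers of 1/2
   are at most 1. *)
- case: ifP => [/critc Bc|_]; first by rewrite Bc ltnn in gt.
  rewrite add0r; apply: le_trans (ler_norm _) _.
  have h0 : 0 <= (1 / 2) ^+ (k - #|B|) :> R by rewrite exprn_ge0 // divr_ge0.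
  have h1 : (1 / 2) ^+ (k - #|B|) <= 1 :> R.
    exact: exprn_ile1.
  have tB : 0 <= t ^+ #|B| by rewrite exprn_ge0.
  have tc : t ^+ #|B| <= t ^+ c.+1 by rewrite ler_wiXn2l.
  rewrite 3!normrM (ger0_norm h0) (ger0_norm tB) ger0_norm //.
  rewrite [leRHS]mulrCA -!mulrA ler_pM2l //.
  apply: ler_pM; rewrite ?mulr_ge0 //.
  by rewrite ler_piMl.
- rewrite eq; case: ifPn => [Bc|nBc]; first by rewrite lerDl.
  have -> : T = 0 by apply: Lambda_induced_trivial => //; apply: not_critical_trivial.
  by rewrite normr0 !mulr0 addr0.
Qed.

Theorem theorem3p1 (R : realType) (F : finFieldType) (m k : nat)
    (hm : (2 <= m)%N) (hmk : (m < k)%N)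
    (L : 'M[F]_(m, k)) (hL : row_free L)
    (hf : exists (n : nat) (f : 'rV[F]_n -> R),
        [/\ (1 <= n)%N,
            forall x, - (1 / 2) <= f x <= 1 / 2,
            balanced f &
            \sum_(B in critical_sets L) Lambda (induced_mx L B) f < 0]) :
  uncommon R L.
Proof.
case: hf => n [f [n1 fb f0 Sneg]] comL.
(* A negative sum is not empty, so some critical set exists. *)
have c0 : (0 < crit_size L)%N.
  have [noB|[B /critical_card_gt0 //]] := set_0Vmem (critical_sets L).
  by move: Sneg; rewrite noB big_set0 ltxx.
set c := crit_size L in c0 *.
set S := \sum_(B in _) _ in Sneg.
pose d : R := 2 * (1 / 2) ^+ (k - c).
pose C : R := \sum_(B : {set 'I_k}) 2 * `|Lambda (induced_mx L B) f|.
have C0 : 0 <= C by apply: sumr_ge0 => B _; rewrite mulr_ge0.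
have d0 : 0 < d by rewrite mulr_gt0 // exprn_gt0 // divr_gt0.
have dS : 0 < - (d * S) by rewrite -mulrN mulr_gt0 // oppr_gt0.
(* The denominator exceeds [- (d * S)], whence [t <= 1], and also exceeds [C], whence
   [t * C < - (d * S)]: the critical term beats the error. *)
pose t : R := - (d * S) / (C + 1 - d * S).
have D0 : 0 < C + 1 - d * S by lra.
have t0 : 0 < t by rewrite divr_gt0.
have t1 : t <= 1 by rewrite ler_pdivrMr //; lra.
have tfb x : - (1 / 2) <= t * f x <= 1 / 2.
  by have /andP[f1 f2] := fb x; apply/andP; split; nra.
have t01 : 0 <= t <= 1 by rewrite ltW.
have := comL n _ n1 tfb; rewrite leNgt => /negP; apply.
apply: le_lt_trans (Delta_le f0 c0 t01) _.
have -> : (2 : R) ^ (1 - k%:Z) = 2 * (1 / 2) ^+ k.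
  by rewrite expfzDr ?pnatr_eq0 // div1r exprVn exprnN.
rewrite -/c -/S -/C -addrA gtrDl.
have -> : 2 * t ^+ c * (1 / 2) ^+ (k - c) * S + t ^+ c.+1 * C =
          t ^+ c * (d * S + t * C).
  rewrite exprS mulrDr (mulrAC 2) -/d (mulrC d (t ^+ c)).
  by rewrite (mulrC t (t ^+ c)) -!(mulrA (t ^+ c)).
rewrite pmulr_rlt0 ?exprn_gt0 // -ltrBrDl sub0r /t mulrAC ltr_pdivrMr //.
by rewrite ltr_pM2l // -addrA ltrDl addr_gt0.
Qed.
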